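(* Let $\mathcal V$ be a finite nonempty set, $m\ge1$, $\bar h\ge0$, let $a_{ij},d_i:[0,\infty)\to[0,\infty)$ be locally Lebesgue integrable and $h_{ij}:[0,\infty)\to[0,\bar h]$ Lebesgue measurable. The algorithm $$\dot x_i(t)=\sum_{j\in\mathcal V,\ j\ne i}a_{ij}(t)\bigl(x_j(t-h_{ij}(t))-x_i(t)\bigr)+d_i(t)\bigl(\omega_i(t)-x_i(t)\bigr)\in\mathbb R^m,\qquad i\in\mathcal V,$$ provides target aggregation for any choice of the nonempty closed convex set $\Omega\subset\mathbb R^m$ and of the Lebesgue measurable, locally $L_1$-summable functions $\omega_i:[0,\infty)\to\Omega$ (such that $d_i\omega_i$ is locally integrable) if and only if the damped averaging dynamics $$\dot x_i(t)=-d_i(t)x_i(t)+\sum_{j\in\mathcal V,\ j\ne i}a_{ij}(t)\bigl(x_j(t-h_{ij}(t))-x_i(t)\bigr),\qquad i\in\mathcal V,$$ are asymptotically stable.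
   Context: For a starting time $t_*\ge0$, the initial condition prescribes $x_i(t_* )$ and $x_i(t_*+s)=\varphi_i(s)$, $s\in[-\bar h,0)$, with $\varphi_i$ bounded Borel; the solution is locally absolutely continuous on $[t_*,\infty)$ and satisfies the equation for almost all $t\ge t_*$. The algorithm provides target aggregation (in $\Omega$) if for every starting time and any initial condition $\operatorname{dist}(x_i(t),\Omega)\to0$ as $t\to\infty$ for all $i\in\mathcal V$ (Euclidean distance from a point to a set). The (linear, scalar-valued $x_i(t)\in\mathbb R$) damped system is asymptotically stable if its zero solution is Lyapunov stable (with respect to the supremum norm of initial data, for each $t_*$) and, for every $t_*\ge0$, every solution started at $t_*$ converges to $0$ as $t\to\infty$. *)

(* Defs.v *)
From HB Require Import structures.
From mathcomp Require Import all_boot all_order all_algebra.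
From mathcomp Require Import all_classical all_reals all_analysis.

Set Implicit Arguments.
Unset Strict Implicit.
Unset Printing Implicit Defensive.

Import Order.TTheory GRing.Theory Num.Theory.
Import numFieldNormedType.Exports.
Local Open Scope classical_set_scope.
Local Open Scope ring_scope.

(* The real line with its Lebesgue (Caratheodory) sigma-algebra; the default
   measurable structure on R is the Borel one. *)
Definition lebesgueTypeR (R : realType) :=
  caratheodory_type ((@wlength R idfun)^*)%mu.

Definition lebesgue_measurable_fun (R : realType) (D : set R) (f : R -> R) :=
  measurable_fun (D : set (lebesgueTypeR R)) (f : lebesgueTypeR R -> R).

(* Functions are total on R, but only their values on [0, +oo[ matter.
   Integrability includes Lebesgue measurability. *)
Definition locally_summable (R : realType) (f : R -> R) :=
  forall T : R, 0 <= T ->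
    (@completed_lebesgue_measure R).-integrable `[0, T] (EFin \o f).

Definition locally_abs_continuous (R : realType) (E : normedModType R)
    (t0 : R) (f : R -> E) :=
  forall T : R, t0 <= T -> forall e : R, 0 < e ->
  exists2 delta : R, 0 < delta &
    forall (n : nat) (u v : 'I_n -> R),
      (forall k, [/\ t0 <= u k, u k <= v k & v k <= T]) ->
      trivIset setT (fun k => `]u k, v k[%classic) ->
      \sum_(k < n) (v k - u k) < delta ->
      \sum_(k < n) `|f (v k) - f (u k)| < e.

Definition borel_measurable_fun (R : realType) (E : normedModType R)
    (D : set R) (f : R -> E) :=
  measurable_fun D (f : R -> g_sigma_algebraType (@open E)).

Section DelaySystems.
Variables (R : realType) (V : finType).

(* The history phi i lives on [- hb, 0[ and is empty when hb = 0; the value at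
   the starting time is prescribed separately. *)
Definition admissible_history (E : normedModType R) (hb : R)
    (phi : V -> R -> E) :=
  forall i, borel_measurable_fun `[- hb, 0[ (phi i) /\
            [bounded phi i s | s in `[- hb, 0[].

Definition solution (E : normedModType R) (hb : R)
    (F : (V -> R -> E) -> V -> R -> E)
    (ts : R) (x0 : V -> E) (phi : V -> R -> E) (x : V -> R -> E) :=
  forall i,
  [/\ x i ts = x0 i,
      {in `[- hb, 0[, forall s, x i (ts + s) = phi i s},
      locally_abs_continuous ts (x i) &
      {ae lebesgue_measure, forall t : R, ts <= t ->
        is_derive t 1 (x i) (F x i t)}].

Variables (hb : R) (a h : V -> V -> R -> R) (d : V -> R -> R).

Definition target_dynamics (m : nat) (omega : V -> R -> 'rV[R]_m)
    (x : V -> R -> 'rV[R]_m) (i : V) (t : R) : 'rV[R]_m :=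
  \sum_(j | j != i) a i j t *: (x j (t - h i j t) - x i t)
  + d i t *: (omega i t - x i t).

Definition damped_dynamics (x : V -> R -> R) (i : V) (t : R) : R :=
  - d i t * x i t + \sum_(j | j != i) a i j t * (x j (t - h i j t) - x i t).

(* The norm `|_| of 'rV[R]_m is the sup norm. *)
Definition euclidean_norm (m : nat) (v : 'rV[R]_m) : R :=
  Num.sqrt (\sum_(k < m) v ord0 k ^+ 2).

Definition euclidean_dist (m : nat) (v : 'rV[R]_m) (A : set 'rV[R]_m) : R :=
  inf [set euclidean_norm (v - w) | w in A].

Definition target_aggregation (m : nat) (Omega : set 'rV[R]_m)
    (omega : V -> R -> 'rV[R]_m) :=
  forall (ts : R) (x0 : V -> 'rV[R]_m) (phi x : V -> R -> 'rV[R]_m),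
    0 <= ts -> admissible_history hb phi ->
    solution hb (target_dynamics omega) ts x0 phi x ->
    forall i, euclidean_dist (x i t) Omega @[t --> +oo] --> (0 : R).

Definition init_sup_norm (x0 : V -> R) (phi : V -> R -> R) : R :=
  sup ([set `|x0 i| | i in [set: V]] `|`
       [set `|phi i s| | i in [set: V] & s in `[- hb, 0[]).

Definition damped_lyapunov_stable :=
  forall ts : R, 0 <= ts -> forall e : R, 0 < e ->
  exists2 delta : R, 0 < delta &
    forall (x0 : V -> R) (phi x : V -> R -> R),
      admissible_history hb phi ->
      solution hb damped_dynamics ts x0 phi x ->
      init_sup_norm x0 phi < delta ->
      forall (i : V) (t : R), ts <= t -> `|x i t| < e.

Definition damped_attractive :=
  forall (ts : R) (x0 : V -> R) (phi x : V -> R -> R),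
    0 <= ts -> admissible_history hb phi ->
    solution hb damped_dynamics ts x0 phi x ->
    forall i, x i t @[t --> +oo] --> (0 : R).

Definition damped_asymptotically_stable :=
  damped_lyapunov_stable /\ damped_attractive.

Definition admissible_target (m : nat) (Omega : set 'rV[R]_m)
    (omega : V -> R -> 'rV[R]_m) :=
  forall i,
  [/\ forall t, 0 <= t -> Omega (omega i t),
      forall k, locally_summable (fun t => omega i t ord0 k) &
      forall k, locally_summable (fun t => d i t * omega i t ord0 k)].

End DelaySystems.

(* Main.v *)
Require Import Defs.
From mathcomp Require Import all_boot all_order all_algebra.
From mathcomp Require Import all_classical all_reals all_analysis.
From mathcomp Require Import measurable_realfun.
From mathcomp Require Import lra ring.

Import Order.TTheory GRing.Theory Num.Theory.
Import numFieldNormedType.Exports.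
Local Open Scope classical_set_scope.
Local Open Scope ring_scope.

Set Implicit Arguments.
Unset Strict Implicit.
Unset Printing Implicit Defensive.

(** Both systems are governed by one comparison principle.  A family [w] with
  [w_i' <= - d_i w_i + sum_j a_ij (w_j (t - h_ij) - w_i)] almost everywhere and
  [w <= 0] on the initial window stays nonpositive ([comparison]).  Indeed, let
  [M] be the maximum over all [i] of [w_i] on a bounded interval, attained by
  [w_i] at time [c], and suppose [M > 0].  With [A_i] the primitive of the total
  rate [d_i + sum_j a_ij], the function [exp A_i * (w_i - M)] has a nonpositive
  derivative almost everywhere up to [c], because every delayed value is at most
  [M]; so [0 = w_i c - M <= exp (- A_i c) * (w_i ts - M) < 0], which is absurd.

  Stability of the damped dynamics implies target aggregation as follows.  Let
  [y] be the solution of the damped dynamics with all initial data equal to one.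
  For a half-space [<n, w> <= s] containing the target set, the signed distances
  [<n, x_i> - s] form a subsolution of the damped dynamics, hence are at most
  [C y_i], where [C] depends on the initial data only and is uniform in
  [(n, s)].  At every time the distance from [x_i t] to the target set is
  [<n, x_i t> - s] for the half-space orthogonal to the segment from [x_i t] to
  its projection, so it is at most [|C y_i t|], which tends to zero
  ([aggregation_of_attraction]).  Working with one fixed half-space at a time
  keeps everything linear: the distance itself is never differentiated.

  That such a [y] exists ([damped_solution_exists]) is shown by monotone
  iteration: in integrated form [y] is a fixed point of a monotone operator that
  maps the constant one below itself, so its iterates decrease and dominated
  convergence passes to the limit.

  Conversely, aggregation for the target set {0} is attractivity, by embedding a
  scalar solution diagonally ([attraction_of_aggregation]), and Lyapunov
  stability always holds, by comparing [x] and [- x] with the constant supremum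
  of the initial data ([damped_stable]).

  The analytic input is that an absolutely continuous function with nonpositive
  derivative almost everywhere is nonincreasing ([ac_nonincreasing]) and that the
  primitive of a locally summable function is absolutely continuous and
  differentiates back to it almost everywhere ([primitive_ac],
  [primitive_derive]). *)

(** * Absolutely continuous functions with nonpositive derivative *)

Section Chains.
Context {R : realType}.
Implicit Types (P : R -> R -> Prop) (f : R -> R).

Inductive chain P : R -> R -> Prop :=
| chain_nil s : chain P s s
| chain_cons s t u : s <= t -> P s t -> chain P t u -> chain P s u.

Lemma chain_le P s t : chain P s t -> s <= t.
Proof. by elim=> // {}s {}t u st _ _; exact: le_trans. Qed.

Lemma chain_rcons P s t u : chain P s t -> t <= u -> P t u -> chain P s u.
Proof.
elim=> [{}s su Psu|{}s r {}t sr Psr _ IH tu Ptu].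
  exact: chain_cons su Psu (chain_nil _ _).
exact: chain_cons sr Psr (IH tu Ptu).
Qed.

(** Cousin's lemma, in the form of an induction along an interval: the supremum
of the points reachable by a chain is itself reachable, and unless it is [b] one
can step past it. *)
Lemma chain_of_local P a b : a <= b ->
  (forall c, a <= c <= b -> exists2 r : R, 0 < r &
     forall s t, c - r < s -> s <= c -> c <= t -> t < c + r ->
       P s c /\ P c t) ->
  chain P a b.
Proof.
move=> ab loc.
pose S := [set t | a <= t <= b /\ chain P a t].
have Sa : S a by split; [rewrite lexx ab | exact: chain_nil].
have Sub : has_sup S.
  by split; [exists a | exists b => t [/andP[]]].
pose c := sup S.
have ac : a <= c by exact: sup_upper_bound.
have cb : c <= b by apply: ge_sup; [exists a | move=> t [/andP[]]].
have [|r r0 Pr] := loc c; first by rewrite ac cb.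
have [s [/andP[as_ sb] cs] rs] := sup_adherent r0 Sub; rewrite -/c in rs.
have sc : s <= c by apply: sup_upper_bound => //; split => //; rewrite as_ sb.
have chac : chain P a c.
  by apply: (chain_rcons cs sc); apply: (Pr s c rs sc _ _).1; rewrite ?ltrDl.
have [cltb|bc] := ltP c b; last by rewrite (_ : b = c)//; apply/eqP; rewrite eq_le cb bc.
pose t := Order.min b (c + r / 2).
have ct : c < t by rewrite lt_min cltb ltrDl divr_gt0.
have tr : t < c + r by rewrite gt_min; apply/orP; right; lra.
have St : S t.
  split; first by rewrite ge_min lexx (le_trans ac (ltW ct)).
  apply: (chain_rcons chac (ltW ct)).
  by apply: (Pr c t _ _ (ltW ct) tr).2; rewrite ?ltrBlDr ?ltrDl.
have := sup_upper_bound Sub St.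
by rewrite leNgt ct.
Qed.

(** The form in which a chain meets the definition of absolute continuity.
[nu t] is to be read as the measure of the part of an exceptional open set below
[t], so a step with [t - s <= nu t - nu s] lies in that set.  These steps are
disjoint and telescoping bounds their total length, while the remaining steps
increase [f] with slope at most [e]. *)
Lemma chain_family f (nu : R -> R) (e : R) a b :
  0 <= e -> {homo nu : s t / s <= t} ->
  chain (fun s t => f t - f s <= e * (t - s) \/ t - s <= nu t - nu s) a b ->
  exists n (u v : 'I_n -> R),
   [/\ forall k, [/\ a <= u k, u k <= v k & v k <= b],
       trivIset setT (fun k => `]u k, v k[%classic),
       \sum_(k < n) (v k - u k) <= nu b - nu a &
       f b - f a <= e * (b - a) + \sum_(k < n) `|f (v k) - f (u k)| ].
Proof.
move=> e0 nuh; elim=> [s|s t u0 st Pst ch [n [u [v [uv tr le1 le2]]]]].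
  exists 0%N, (fun=> 0), (fun=> 0); split.
  - by case.
  - by move=> [].
  - by rewrite big_ord0 subrr.
  - by rewrite big_ord0 !subrr mulr0 addr0.
have tu := chain_le ch.
case: Pst => [good|bad].
  exists n, u, v; split => //.
  - by move=> k; have [h1 h2 h3] := uv k; split => //; exact: le_trans h1.
  - by rewrite (le_trans le1)// lerB// nuh.
  - by lra.
exists n.+1, (fun k => oapp u s (unlift ord0 k)), (fun k => oapp v t (unlift ord0 k)).
split.
- move=> k; case: (unliftP ord0 k) => [j _|_] //=.
  by have [h1 h2 h3] := uv j; split => //; exact: le_trans h1.
- move=> i j _ _; case: (unliftP ord0 i) => [i' ->|->];
    case: (unliftP ord0 j) => [j' ->|->] //=.
  + by move=> h; congr lift; exact: tr h.
  + case=> x []; rewrite /= !in_itv/= => /andP[h1 h2] /andP[h3 h4].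
    have [h5 _ _] := uv i'.
    by have := lt_trans (le_lt_trans h5 h1) h4; rewrite ltxx.
  + case=> x []; rewrite /= !in_itv/= => /andP[h1 h2] /andP[h3 h4].
    have [h5 _ _] := uv j'.
    by have := lt_trans (le_lt_trans h5 h3) h2; rewrite ltxx.
- rewrite big_ord_recl/= unlift_none/=.
  under eq_bigr do rewrite liftK/=.
  lra.
- rewrite big_ord_recl/= unlift_none/=.
  under eq_bigr do rewrite liftK/=.
  have h1 := ler_norm (f t - f s).
  have h2 : 0 <= e * (t - s) by rewrite mulr_ge0// subr_ge0.
  lra.
Qed.
End Chains.

Section Monotone.
Context {R : realType}.
Notation mu := (@lebesgue_measure R).

Lemma is_derive_le0_near (f : R -> R) (c D e : R) :
  is_derive c 1 f D -> D <= 0 -> 0 < e ->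
  exists2 r : R, 0 < r & forall s t, c - r < s -> s <= c -> c <= t -> t < c + r ->
    f c - f s <= e * (c - s) /\ f t - f c <= e * (t - c).
Proof.
move=> [df Dv] D0 e0.
have : (fun h => h^-1 *: ((f \o shift c) (h *: (1 : R)) - f c)) @ 0^' --> D.
  by rewrite -Dv; exact: df.
move=> /cvgrPdist_lt /(_ _ e0)[/= r r0 fr].
exists r => // s t rs sc ct tr; split.
- move: sc; rewrite le_eqVlt => /predU1P[->|sc]; first by rewrite !subrr mulr0.
  have := fr (s - c); rewrite /ball_/= sub0r normrN ltr0_norm ?subr_lt0// opprB.
  have -> : c - s < r by lra.
  rewrite subr_eq0 lt_eqF// => /(_ isT isT).
  rewrite [_%:A]mulr1 subrK ltr_norml => /andP[+ _].
  rewrite ltrBrDl; set q := _ *: _ => h.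
  have : q < e by lra.
  by rewrite /q /GRing.scale/= mulrC ltr_ndivrMr ?subr_lt0//; nra.
- move: ct; rewrite le_eqVlt => /predU1P[->|ct]; first by rewrite !subrr mulr0.
  have := fr (t - c); rewrite /ball_/= sub0r normrN gtr0_norm ?subr_gt0//.
  have -> : t - c < r by lra.
  rewrite subr_eq0 gt_eqF// => /(_ isT isT).
  rewrite [_%:A]mulr1 subrK ltr_norml => /andP[+ _].
  set q := _ *: _ => h.
  have : q < e by lra.
  by rewrite /q /GRing.scale/= mulrC ltr_pdivrMr ?subr_gt0// => /ltW.
Qed.

(** [U] is an open cover of [N] of measure less than [de], and [nu t] is the
measure of [U] below [t]: lengths of intervals inside [U] become increments of
[nu], whose sum over a chain telescopes. *)
Lemma small_cover_function (N : set R) (de : R) : measurable N -> mu N = 0%E ->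
  0 < de -> exists (U : set R) (nu : R -> R),
  [/\ open U, N `<=` U, {homo nu : s t / s <= t},
      forall s t, nu t - nu s < de &
      forall s t, s <= t -> `[s, t] `<=` U -> t - s <= nu t - nu s].
Proof.
move=> mN N0 de0.
have [|U [oU NU mU]] := @lebesgue_regularity_outer R N de mN _ de0.
  by rewrite [ltLHS]N0 ltry.
have mU' : measurable U by exact: open_measurable.
have muU : (mu U < de%:E)%E.
  have -> : U = (U `\` N) `|` N by rewrite setUC setDUK.
  rewrite (le_lt_trans (measureU2 _ _ _))//; first exact: measurableD.
  by rewrite [X in (_ + X)%E]N0 adde0.
pose m (A : set R) := mu (U `&` A).
have mle (A B : set R) : measurable A -> measurable B -> A `<=` B -> (m A <= m B)%E.
  by move=> mA mB AB; rewrite le_measure ?inE//; [exact: measurableI|exact: measurableI|exact: setIS].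
have mA (A : set R) : measurable A -> (m A <= mu U)%E.
  by move=> mA; rewrite le_measure ?inE//; exact: measurableI.
have mfin (A : set R) : measurable A -> m A \is a fin_num.
  move=> /mA h; rewrite ge0_fin_numE// (le_lt_trans h)//.
  by rewrite (lt_trans muU)// ltry.
exists U, (fun t => fine (m `]-oo, t]%classic)); split => //.
- move=> s t st; rewrite fine_le ?mfin//= mle//.
  by move=> x; rewrite /= !in_itv/= => /le_trans; apply.
- move=> s t.
  have h : fine (m `]-oo, t]%classic) < de.
    by rewrite -lte_fin fineK ?mfin// (le_lt_trans (mA _ _)).
  have : 0 <= fine (m `]-oo, s]%classic) by rewrite fine_ge0.
  lra.
- move=> s t st stU.
  rewrite -lee_fin !EFinB !fineK ?mfin//.
  have -> : m `]-oo, t]%classic = (m `]-oo, s]%classic + m `]s, t]%classic)%E.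
    rewrite /m -measureU//; [|exact: measurableI|exact: measurableI|].
      by rewrite -setIUr -itv_bndbnd_setU ?bnd_simp.
    rewrite setIACA (_ : _ `&` `]s, t]%classic = set0) ?setI0//.
    by apply/seteqP; split=> // x []; rewrite /= !in_itv/=; lra.
  rewrite addeAC subee ?mfin// add0e /m (_ : U `&` _ = `]s, t]%classic).
    rewrite lebesgue_measure_itv/= lte_fin; case: ltP => // h.
    by rewrite -EFinB (_ : t = s) ?subrr//; apply/eqP; rewrite eq_le st h.
  apply/setIidPr; apply: subset_trans stU.
  by apply: subset_itv; rewrite bnd_simp.
Qed.

(** Off a null set, small steps around a point increase [f] by at most [e1] times
their length; the null set is covered by an open set so small that, by absolute
continuity, [f] varies by less than [e1] over disjoint intervals in it.  A chain
mixing both kinds of steps runs from [a] to [b]. *)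
Lemma ac_nonincreasing (f : R -> R) a b : a <= b ->
  locally_abs_continuous a f ->
  {ae mu, forall t, a <= t <= b -> exists2 D : R, is_derive t 1 f D & D <= 0} ->
  f b <= f a.
Proof.
move=> ab acf [N [mN N0 badN]].
apply/ler_addgt0Pr => e e0.
(* chosen so that the slope over [[a, b]] and the variation over the
   exceptional set together cost exactly [e] *)
pose e1 := e / (1 + (b - a)).
have ba0 : 0 < 1 + (b - a) by lra.
have e10 : 0 < e1 by rewrite divr_gt0.
have [de de0 acde] := acf b ab _ e10.
have [U [nu [oU NU nuh nude nuU]]] := small_cover_function mN N0 de0.
have ch : chain (fun s t => f t - f s <= e1 * (t - s) \/ t - s <= nu t - nu s) a b.
  apply: chain_of_local => // c acb.
  have [Nc|Nc] := pselect (N c).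
    have [r /= r0 rU] := open_itvoo_subset oU (NU _ Nc).
    have {}rU : `]c - r / 2, c + r / 2[ `<=` U.
      by apply: rU; rewrite ?divr_gt0//= sub0r normrN gtr0_norm ?divr_gt0//; lra.
    exists (r / 2); first by rewrite divr_gt0.
    move=> s t h1 h2 h3 h4; split; right; apply: nuU => // x /=; rewrite in_itv/= => hx;
      by apply: rU; rewrite /= in_itv/=; lra.
  have [D fD D0] : exists2 D : R, is_derive c 1 f D & D <= 0.
    by apply: contrapT => h; apply: Nc; apply: badN => /(_ acb).
  have [r r0 fr] := is_derive_le0_near fD D0 e10.
  by exists r => // s t h1 h2 h3 h4; have [] := fr s t h1 h2 h3 h4; split; left.
have [n [u [v [uv tr le1 le2]]]] := chain_family (ltW e10) nuh ch.
have := acde n u v uv tr (le_lt_trans le1 (nude _ _)).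
have : e = e1 + e1 * (b - a) by rewrite /e1; field; lra.
lra.
Qed.
End Monotone.

(** * Closure properties of absolute continuity *)

Section AbsCont.
Context {R : realType}.
Implicit Types (E F G : normedModType R).

(** All closure properties below reduce to this one: on each compact interval the
increments of [f] are controlled by those of [g1] and [g2]. *)
Lemma ac_dominated E F G (t0 : R) (f : R -> E) (g1 : R -> F) (g2 : R -> G) :
  (forall T, t0 <= T -> exists2 C : R, 0 < C & forall u v, t0 <= u -> u <= v -> v <= T ->
    `|f v - f u| <= C * (`|g1 v - g1 u| + `|g2 v - g2 u|)) ->
  locally_abs_continuous t0 g1 -> locally_abs_continuous t0 g2 ->
  locally_abs_continuous t0 f.
Proof.
move=> dom ac1 ac2 T t0T e e0.
have [C C0 CP] := dom T t0T.
have e'0 : 0 < e / C / 2 by rewrite !divr_gt0.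
have [d1 d10 h1] := ac1 T t0T _ e'0.
have [d2 d20 h2] := ac2 T t0T _ e'0.
exists (Order.min d1 d2); first by rewrite lt_min d10 d20.
move=> n u v uv tr; rewrite lt_min => /andP[l1 l2].
have {}h1 := h1 n u v uv tr l1.
have {}h2 := h2 n u v uv tr l2.
apply: (@le_lt_trans _ _ (C * (\sum_(k < n) `|g1 (v k) - g1 (u k)| +
                          \sum_(k < n) `|g2 (v k) - g2 (u k)|))).
  rewrite -big_split mulr_sumr/=; apply: ler_sum => k _.
  by have [? ? ?] := uv k; exact: CP.
rewrite mulrC -ltr_pdivlMr//; lra.
Qed.

Lemma ac_cst E (t0 : R) (c : E) : locally_abs_continuous t0 (fun=> c).
Proof.
move=> T _ e e0; exists 1 => // n u v _ _ _.
by rewrite big1// => k _; rewrite subrr normr0.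
Qed.

Lemma ac_continuous_at E (t0 : R) (f : R -> E) : locally_abs_continuous t0 f ->
  forall t, t0 <= t -> forall e, 0 < e -> exists2 de : R, 0 < de &
  forall s, t0 <= s -> `|s - t| < de -> `|f s - f t| < e.
Proof.
move=> acf t t0t e e0; have [|de de0 h] := acf (t + 1) _ e e0.
  by lra.
exists (Order.min de 1); first by rewrite lt_min de0 ltr01.
move=> s t0s; rewrite lt_min => /andP[sde s1].
have [st|ts] := leP s t.
  have := h 1%N (fun=> s) (fun=> t); rewrite !big_ord1 distrC; apply.
  - by move=> _; split => //; lra.
  - by move=> i j _ _ _; rewrite !ord1.
  - by move: sde; rewrite ltr_norml; lra.
have := h 1%N (fun=> t) (fun=> s); rewrite !big_ord1; apply.
- by move=> _; split => //; [exact: ltW|move: s1; rewrite ltr_norml; lra].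
- by move=> i j _ _ _; rewrite !ord1.
- by move: sde; rewrite ltr_norml; lra.
Qed.

(** Only the values on [[t0, +oo[] are constrained, hence the truncation. *)
Lemma ac_continuous E (t0 : R) (f : R -> E) : locally_abs_continuous t0 f ->
  continuous (fun t => f (Order.max t0 t)).
Proof.
move=> acf t; apply/cvgrPdist_lt => e e0.
have [|de de0 h] := ac_continuous_at acf (t := Order.max t0 t) _ e0.
  by rewrite le_max lexx.
near=> s; rewrite distrC; apply: h; first by rewrite le_max lexx.
have : `|t - s| < de by near: s; exact: cvgr_dist_lt.
rewrite !ltr_norml => /andP[h1 h2].
by rewrite /Order.max; case: ifP => ?; case: ifP => ?; lra.
Unshelve. all: by end_near. Qed.

Lemma ac_bounded E (t0 T : R) (f : R -> E) : locally_abs_continuous t0 f ->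
  exists2 M : R, 0 < M & forall t, t0 <= t <= T -> `|f t| <= M.
Proof.
move=> acf; have [t0T|Tt0] := leP t0 T; last first.
  by exists 1 => // t; lra.
have [|c _ cP] := @EVT_max R (fun t => `|f (Order.max t0 t)|) t0 T t0T.
  apply: continuous_subspaceT => t.
  by apply: cvg_norm; exact: ac_continuous.
exists (`|f (Order.max t0 c)| + 1); first by rewrite ltr_wpDl.
move=> t tt; have := cP t; rewrite in_itv/= tt => /(_ isT).
by rewrite max_r; lra.
Qed.

Lemma acD E (t0 : R) (f g : R -> E) : locally_abs_continuous t0 f ->
  locally_abs_continuous t0 g -> locally_abs_continuous t0 (fun t => f t + g t).
Proof.
apply: ac_dominated => T _; exists 1 => // u v _ _ _.
by rewrite mul1r opprD addrACA ler_normD.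
Qed.

Lemma acM (t0 : R) (f g : R -> R) : locally_abs_continuous t0 f ->
  locally_abs_continuous t0 g -> locally_abs_continuous t0 (fun t => f t * g t).
Proof.
move=> acf acg; apply: (ac_dominated _ acf acg) => T _.
have [M M0 fM] := ac_bounded T acf.
have [N N0 gN] := ac_bounded T acg.
exists (M + N); first by rewrite addr_gt0.
move=> u v tu uv vT.
have -> : f v * g v - f u * g u = (f v - f u) * g v + f u * (g v - g u) by ring.
rewrite (le_trans (ler_normD _ _))// !normrM.
have h1 : `|f u| <= M by apply: fM; lra.
have h2 : `|g v| <= N by apply: gN; lra.
have h3 := normr_ge0 (f v - f u).
have h4 := normr_ge0 (g v - g u).
nra.
Qed.

Lemma acZ (t0 : R) (k : R) (f : R -> R) : locally_abs_continuous t0 f ->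
  locally_abs_continuous t0 (fun t => k * f t).
Proof. by move=> acf; apply: acM => //; exact: ac_cst. Qed.

Lemma acB (t0 : R) (f g : R -> R) : locally_abs_continuous t0 f ->
  locally_abs_continuous t0 g -> locally_abs_continuous t0 (fun t => f t - g t).
Proof.
apply: ac_dominated => T _; exists 1 => // u v _ _ _.
have -> : f v - g v - (f u - g u) = (f v - f u) - (g v - g u) by ring.
by rewrite mul1r ler_normB.
Qed.

Lemma ac_expR (t0 : R) (f : R -> R) : locally_abs_continuous t0 f ->
  locally_abs_continuous t0 (fun t => expR (f t)).
Proof.
move=> acf; apply: (ac_dominated _ acf acf) => T _.
have [M M0 fM] := ac_bounded T acf.
exists (expR M); first exact: expR_gt0.
have key x y : x <= M -> y <= x -> expR x - expR y <= expR M * (x - y).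
  move=> xM yx; have : expR x * (1 + (y - x)) <= expR x * expR (y - x).
    by rewrite ler_pM2l ?expR_gt0// expR_ge1Dx.
  rewrite -expRD (addrC x) subrK => h.
  have h2 : expR x <= expR M by rewrite ler_expR.
  have h3 : 0 <= (expR M - expR x) * (x - y) by rewrite mulr_ge0 ?subr_ge0.
  lra.
move=> u v tu uv vT.
have h1 : `|f u| <= M by apply: fM; lra.
have h2 : `|f v| <= M by apply: fM; lra.
have h3 := normr_ge0 (f v - f u).
have h4 : 0 < expR M by exact: expR_gt0.
have [fuv|fuv] := leP (f u) (f v).
  rewrite !ger0_norm ?subr_ge0 ?ler_expR//.
  have := key (f v) (f u) (le_trans (ler_norm _) h2) fuv; nra.
rewrite !ler0_norm ?subr_le0 ?ler_expR ?(ltW fuv)// ?opprB.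
have := key (f u) (f v) (le_trans (ler_norm _) h1) (ltW fuv); nra.
Qed.

Lemma ac_sum (I : Type) (r : seq I) (P : pred I) (t0 : R) (f : I -> R -> R) :
  (forall i, P i -> locally_abs_continuous t0 (f i)) ->
  locally_abs_continuous t0 (fun t => \sum_(i <- r | P i) f i t).
Proof.
move=> acf; elim: r => [|i r IH].
  by under eq_fun do rewrite big_nil; exact: ac_cst.
have [Pi|/negbTE Pi] := boolP (P i).
  under eq_fun do rewrite big_cons Pi.
  exact: acD (acf _ Pi) IH.
under eq_fun do rewrite big_cons Pi.
exact: IH.
Qed.

End AbsCont.

(** * Lebesgue measurable functions and their primitives *)

Section BorelVersion.
Context {R : realType}.
Notation mu := (@lebesgue_measure R).
Notation cmu := (@completed_lebesgue_measure R).
Notation L := (lebesgueTypeR R).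

Lemma borel_lebesgue (A : set R) : measurable A -> measurable (A : set L).
Proof. by move=> mA; exact: sub_caratheodory. Qed.

Lemma lebesgue_borel_null (A : set R) : measurable (A : set L) ->
  exists B N : set R, [/\ measurable B, measurable N, mu N = 0%E &
    B `\` N = A `\` N].
Proof.
move=> mA.
have : (completed_algebra_gen mu).-sigma.-measurable (A : set R).
  by rewrite completed_caratheodory_measurable.
rewrite g_sigma_completed_algebra_genE => -[B mB [M [N [mN N0 MN]]] <-].
exists B, N; split => //.
apply/seteqP; split => x [] Bx nN; split => //; first by left.
by case: Bx => // /MN.
Qed.

(** The sublevel sets at rational heights determine [f]; each is Borel up to a
null set, and setting [f] to zero on the countable union of these null sets
makes every sublevel set Borel. *)
Lemma borel_version (f : L -> R) : measurable_fun setT f ->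
  exists2 g : R -> R, measurable_fun setT g &
  exists N : set R, [/\ measurable N, mu N = 0%E & forall x, ~ N x -> f x = g x].
Proof.
move=> mf.
have mA (q : rat) : measurable ((f @^-1` `]-oo, (ratr q : R)[%classic) : set L).
  by rewrite -[X in measurable X]setTI; exact: mf.
have /choice[B /choice[M BM]] := fun q => lebesgue_borel_null (mA q).
pose N := \bigcup_q M q.
have mN : measurable N.
  by apply: bigcupT_measurable_rat => q; have [] := BM q.
have N0 : mu N = 0%E.
  apply/negligibleP => //.
  apply: (@negligibleS _ (measurableTypeR R) R mu (\bigcup_n oapp M set0 (unpickle n))) => [x [q _ Mx]|].
    by exists (pickle q); rewrite ?pickleK.
  apply: negligible_bigcup => n; case: unpickle => [q|] /=.
    by have [? ? ? _] := BM q; apply/negligibleP.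
  exact: negligible_set0.
exists (fun x => if x \in N then 0 else f x); last first.
  by exists N; split => // x Nx; rewrite memNset.
apply: (measurability _ (RGenInftyO.measurableE R)) => //.
move=> _ [_ [r ->] <-].
rewrite setTI.
pose S := \bigcup_(q : rat) (if (ratr q < r :> R) then B q `\` N else set0).
have mS : measurable S.
  apply: bigcupT_measurable_rat => q; case: ifP => // _.
  by apply: measurableD => //; have [] := BM q.
have -> : ((fun x => if x \in N then 0 else f x) @^-1` `]-oo, r[) =
    S `|` (if 0 < r then N else set0).
  apply/seteqP; split => x /=; rewrite in_itv/=.
    have [Nx|Nx] := boolP (x \in N).
      by move=> r0; right; rewrite r0; rewrite inE in Nx.
    move=> fr; left; have [q] := rat_in_itvoo fr.
    rewrite in_itv/= => /andP[fq qr]; exists q => //; rewrite qr.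
    have [_ _ _ ] := BM q; rewrite predeqE => /(_ x)[_ h].
    have [|Bx Mx] := h.
      split; first by rewrite /= in_itv.
      by move=> Mx; move: Nx; rewrite notin_setE; apply; exists q.
    by split => //; rewrite notin_setE in Nx.
  case=> [[q _]|]; last by case: ifP => // r0 Nx; rewrite mem_set.
  case: ifP => // qr [Bx Nx]; rewrite memNset//.
  have [_ _ _ ] := BM q; rewrite predeqE => /(_ x)[h _].
  have [|+ _] := h; first by split => // Mx; apply: Nx; exists q.
  by rewrite /= in_itv/= => /lt_trans; apply.
by apply: measurableU => //; case: ifP.
Qed.

(** The Lebesgue measure on Borel sets is the image of its completion under the
identity map. *)
Lemma completed_integrable (g : R -> R) (D : set R) : measurable D ->
  measurable_fun setT g -> cmu.-integrable D (EFin \o g) ->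
  mu.-integrable D (EFin \o g) /\
  (\int[cmu]_(x in D) (g x)%:E = \int[mu]_(x in D) (g x)%:E)%E.
Proof.
move=> mD mg ig.
have mid : measurable_fun setT (@id R : L -> measurableTypeR R).
  by move=> _ A mA; rewrite setTI; exact: borel_lebesgue.
have mg' : measurable_fun setT (EFin \o g) by exact/measurable_EFinP.
have h := integrable_pushforward mid mg' ig mD.
split.
  apply/integrableP; split; first exact: measurable_funTS.
  by have /integrableP[_ ] := h.
have := integral_pushforward mid mg' ig mD.
by move=> <-.
Qed.

End BorelVersion.

Lemma ae_eq_integrable d (T : measurableType d) (R : realType)
    (mu : {measure set T -> \bar R}) (D : set T) (f g : T -> \bar R) :
  measurable D -> measurable_fun D g -> ae_eq mu D f g ->
  mu.-integrable D f -> mu.-integrable D g.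
Proof.
move=> mD mg fg /integrableP[mf foo]; apply/integrableP; split => //.
rewrite (_ : (\int[mu]_(x in D) `|g x| = \int[mu]_(x in D) `|f x|)%E)//.
apply: ge0_ae_eq_integral => //.
- exact: measurableT_comp.
- exact: measurableT_comp.
- by apply: ae_eq_abse; exact: ae_eq_sym.
Qed.

Section Primitive.
Context {R : realType}.
Notation mu := (@lebesgue_measure R).
Notation cmu := (@completed_lebesgue_measure R).
Notation L := (lebesgueTypeR R).

Definition primitive (f : R -> R) (a t : R) : R :=
  (\int[cmu]_(x in `[a, t]) f x)%R.

Lemma lebesgue_measurable_itv (i : interval R) : measurable ([set` i] : set L).
Proof. by apply: borel_lebesgue; exact: measurable_itv. Qed.

Lemma summable_integrable (f : R -> R) a b : locally_summable f -> 0 <= a ->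
  cmu.-integrable `[a, b] (EFin \o f).
Proof.
move=> lf a0; have [ab|ba] := leP a b; last first.
  by rewrite set_itv_ge ?bnd_simp -?ltNge//; exact: integrable_set0.
apply: (@integrableS _ L R cmu `[0, b]%classic);
  [exact: lebesgue_measurable_itv|exact: lebesgue_measurable_itv| |].
  by apply: subset_itv; rewrite bnd_simp.
exact: (lf b (le_trans a0 ab)).
Qed.

(** Reduces primitives for the completed measure to integrals of a Borel function
that is integrable on the whole line, to which the differentiation theorem and
the absolute continuity of the integral apply. *)
Lemma primitive_borel (f : R -> R) (T : R) : locally_summable f -> 0 <= T ->
  exists2 g : R -> R, mu.-integrable setT (EFin \o g) &
  (forall a t : R, 0 <= a -> t <= T -> primitive f a t = \int[mu]_(x in `[a, t]) g x) /\
  exists N : set R, [/\ measurable N, mu N = 0%E &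
    forall x : R, 0 <= x <= T -> ~ N x -> f x = g x].
Proof.
move=> lf T0.
have f1 : cmu.-integrable setT (EFin \o (f \_ `[0, T])).
  have := (integrable_mkcond (mu := cmu) (EFin \o f) (lebesgue_measurable_itv `[0, T])).1 (lf T T0).
  by rewrite restrict_EFin.
have mf1 : measurable_fun setT (f \_ `[0, T] : L -> R).
  by apply/measurable_EFinP; have /integrableP[] := f1.
have [g mg [N [mN N0 fg]]] := borel_version mf1.
have mgL : measurable_fun setT (EFin \o g : L -> _).
  apply: measurableT_comp; first exact: EFin_measurable.
  by move=> _ A mA; rewrite setTI; apply: borel_lebesgue; rewrite -[X in measurable X]setTI; exact: mg.
have mf1' : measurable_fun setT (EFin \o (f \_ `[0, T]) : L -> _).
  by have /integrableP[] := f1.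
have N0' : cmu N = 0%E by exact: N0.
have aeq : {ae cmu, forall x, setT x -> (EFin \o (f \_ `[0, T])) x = (EFin \o g) x}.
  exists N; split => //; first exact: borel_lebesgue.
  move=> x /= h; apply: contrapT => Nx; apply: h => _.
  by rewrite /= fg.
have g1 : cmu.-integrable setT (EFin \o g).
  exact: (ae_eq_integrable _ mgL aeq f1).
have [g2 _] := completed_integrable measurableT mg g1.
exists g => //; split; last first.
  exists N; split => // x xT /fg <-.
  by rewrite patchE mem_set//= in_itv.
move=> a t a0 tT; rewrite /primitive /Rintegral.
have mat := lebesgue_measurable_itv `[a, t].
have g1' : cmu.-integrable `[a, t] (EFin \o g).
  exact: (integrableS measurableT mat).
have [_ <-] := completed_integrable (measurable_itv `[a, t]) mg g1'.
congr fine.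
apply: ae_eq_integral => //.
- by have /integrableP[] := summable_integrable t lf a0.
- exact: measurable_funTS.
- exists N; split => //; first exact: borel_lebesgue.
  move=> x /= h; apply: contrapT => Nx; apply: h.
  rewrite in_itv/= => /andP[ax xt].
  by rewrite -fg// patchE mem_set//= in_itv/= (le_trans a0 ax) (le_trans xt tT).
Qed.

Lemma primitive_id (f : R -> R) (a : R) : locally_summable f -> 0 <= a -> primitive f a a = 0.
Proof.
move=> lf a0; have [g ig [fg _]] := primitive_borel lf a0.
by rewrite fg// set_itv1 Rintegral_set1.
Qed.

(** The increments over disjoint intervals add up to at most the integral of
[`|g|] over their union, a set of small measure. *)
Lemma primitive_ac (f : R -> R) (a : R) : locally_summable f -> 0 <= a ->
  locally_abs_continuous a (primitive f a).
Proof.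
move=> lf a0 T aT e e0.
have [g ig [fg _]] := primitive_borel lf (le_trans a0 aT).
have [de [de0 gde]] := integral_normr_continuous ig e0.
exists de => // n u v uv tr sde.
pose I (k : 'I_n) := `]u k, v k[%classic.
have mI k : measurable (I k) by exact: measurable_itv.
have igD (D : set R) : measurable D -> mu.-integrable D (EFin \o g).
  by move=> mD; exact: (@integrableS _ _ _ mu setT D _ measurableT mD (@subsetT _ _) ig).
pose D := \big[setU/set0]_(k < n) I k.
have mD : measurable D by apply: bigsetU_measurable => k _; exact: mI.
have step k : `|primitive f a (v k) - primitive f a (u k)| <= \int[mu]_(x in I k) `|g x|.
  have [auk ukvk vkT] := uv k.
  rewrite !fg// ?(le_trans ukvk)//.
  rewrite Rintegral_itvB ?bnd_simp//; last exact: igD.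
  rewrite -Rintegral_itv_bndo_bndc; last exact: igD.
  by apply: le_normr_Rintegral => //; exact: igD.
apply: (@le_lt_trans _ _ (\sum_(k < n) \int[mu]_(x in I k) `|g x|)).
  by apply: ler_sum => k _; exact: step.
have mg A : measurable A -> measurable_fun A (fun x => `|g x|).
  move=> mA; apply: measurableT_comp => //; apply/measurable_EFinP.
  by have /integrableP[] := igD A mA.
have -> : \sum_(k < n) \int[mu]_(x in I k) `|g x| = \int[mu]_(x in D) `|g x|.
  rewrite /Rintegral ge0_integral_bigsetU//=.
  - rewrite sum_fine// => k _.
    by apply: integrable_fin_num; [exact: mI|exact: (integrable_abse (igD _ (mI k)))].
  - exact: index_enum_uniq.
  - by apply: sub_trivIset tr.
  - by apply/measurable_EFinP; exact: mg.
apply: gde => //.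
rewrite measure_bigsetU_ord//=.
rewrite (eq_bigr (fun k => (v k - u k)%:E)) ?sumEFin ?lte_fin// => k _.
have [_ ukvk _] := uv k.
rewrite [LHS]lebesgue_measure_itv/= lte_fin; case: ltP => // h.
by rewrite (_ : v k = u k) ?subrr//; apply/eqP; rewrite eq_le h ukvk.
Qed.

(** On each bounded interval [primitive f a] agrees with the integral of a Borel
function, to which the differentiation theorem applies; countably many null sets
are discarded. *)
Lemma primitive_derive (f : R -> R) (a : R) : locally_summable f -> 0 <= a ->
  {ae mu, forall t, a <= t -> is_derive t 1 (primitive f a) (f t)}.
Proof.
move=> lf a0.
have /choice[N NP] (n : nat) : exists N : set R, [/\ measurable N, mu N = 0%E &
   forall t, a < t < a + n%:R -> ~ N t -> is_derive t 1 (primitive f a) (f t)].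
  have T0 : 0 <= a + n%:R by rewrite addr_ge0.
  have [g ig [fg [N [mN N0 fgN]]]] := primitive_borel lf T0.
  have igt y : mu.-integrable [set` Interval (BLeft a) (BRight y)] (EFin \o g).
    by apply: (integrableS measurableT _ _ ig).
  have lg : locally_integrable setT g.
    by have := integrable_locally measurableT ig; rewrite patch_setT.
  have [M [mM M0 MP]] := FTC1 igt lg.
  exists (N `|` M); split.
  - exact: measurableU.
  - by rewrite null_set_setU.
  move=> t /andP[at_ tn] /not_orP[nN nM].
  pose G x := (\int[mu]_(s in `[a, x]) g s)%R.
  have [dG GE] : derivable G t 1 /\ derive1 G t = g t.
    by apply: contrapT => h; apply/nM/MP => /= h'; apply: h; apply: h'; rewrite lte_fin.
  rewrite fgN// ?(le_trans a0 (ltW at_)) ?(ltW tn)//.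
  apply: (@near_eq_is_derive _ _ _ G) => //.
    near=> x; rewrite fg//.
    by apply/ltW; near: x; exact: lt_nbhsl.
  by apply: DeriveDef => //; rewrite -derive1E.
have mUN : measurable (\bigcup_n N n).
  by apply: bigcupT_measurable => n; have [] := NP n.
(* at [a] itself the two-sided derivative need not exist *)
exists ([set a] `|` \bigcup_n N n); split.
- by apply: (@measurableU _ (measurableTypeR R)) => //.
- apply: null_set_setU => //.
    by rewrite [LHS]lebesgue_measure_set1.
  apply: measure_negligible; first exact: mUN.
  apply: negligible_bigcup => n; have [mN N0 _] := NP n.
  by exists (N n); split.
move=> t /= h; apply: contrapT => /not_orP[/eqP ta Nt]; apply: h => at_.
have [n tn] : exists n : nat, t < a + n%:R.
  by exists (Num.bound (t - a)); rewrite -ltrBlDl; apply: archi_boundP; lra.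
have [_ _ ] := NP n; apply.
  by rewrite lt_neqAle eq_sym ta at_.
by move=> Nnt; apply: Nt; exists n.
Unshelve. all: by end_near. Qed.

End Primitive.

Section Summable.
Context {R : realType}.

Lemma summableD (f g : R -> R) : locally_summable f -> locally_summable g ->
  locally_summable (fun t => f t + g t).
Proof.
move=> lf lg T T0; have := integrableD (lebesgue_measurable_itv `[0, T]) (lf T T0) (lg T T0).
by apply: eq_integrable => //; exact: lebesgue_measurable_itv.
Qed.

Lemma summable0 : locally_summable (fun=> 0 : R).
Proof.
move=> T T0; apply: (eq_integrable _ (cst 0%E)) => //.
- exact: lebesgue_measurable_itv.
- exact: integrable0.
Qed.

Lemma summable_sum (I : Type) (r : seq I) (P : pred I) (f : I -> R -> R) :
  (forall i, P i -> locally_summable (f i)) ->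
  locally_summable (fun t => \sum_(i <- r | P i) f i t).
Proof.
move=> lf; elim: r => [|i r IH].
  by under eq_fun do rewrite big_nil; exact: summable0.
have [Pi|/negbTE Pi] := boolP (P i).
  under eq_fun do rewrite big_cons Pi.
  exact: summableD (lf _ Pi) IH.
under eq_fun do rewrite big_cons Pi.
exact: IH.
Qed.
End Summable.

(** * The comparison principle *)

Section AlmostEverywhere.
Context {R : realType}.
Notation mu := (@lebesgue_measure R).

Lemma ae_impl (P Q : R -> Prop) : (forall t, P t -> Q t) ->
  {ae mu, forall t, P t} -> {ae mu, forall t, Q t}.
Proof. by apply: filterS; exact: (ae_filter_ringOfSetsType mu). Qed.

Lemma ae_impl2 (P Q S : R -> Prop) : (forall t, P t -> Q t -> S t) ->
  {ae mu, forall t, P t} -> {ae mu, forall t, Q t} -> {ae mu, forall t, S t}.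
Proof. by apply: filterS2; exact: (ae_filter_ringOfSetsType mu). Qed.

End AlmostEverywhere.

Section Comparison.
Variables (R : realType) (V : finType) (hb : R).
Variables (a h : V -> V -> R -> R) (d : V -> R -> R).
Notation mu := (@lebesgue_measure R).
Hypothesis a_ge0 : forall i j t, 0 <= t -> 0 <= a i j t.
Hypothesis a_int : forall i j, locally_summable (a i j).
Hypothesis d_ge0 : forall i t, 0 <= t -> 0 <= d i t.
Hypothesis d_int : forall i, locally_summable (d i).
Hypothesis h_bnd : forall i j t, 0 <= t -> 0 <= h i j t <= hb.

Definition rate (i : V) (t : R) : R := d i t + \sum_(j | j != i) a i j t.

Definition inflow (x : V -> R -> R) (i : V) (t : R) : R :=
  \sum_(j | j != i) a i j t * x j (t - h i j t).

Lemma damped_dynamicsE x i t :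
  damped_dynamics a h d x i t = inflow x i t - rate i t * x i t.
Proof.
rewrite /damped_dynamics /inflow /rate.
under eq_bigr do rewrite mulrBr.
by rewrite sumrB mulrDl mulr_suml; ring.
Qed.

Lemma rate_summable i : locally_summable (rate i).
Proof. by apply: summableD => //; exact: summable_sum. Qed.

Lemma is_derive_integrating_factor (A : R -> R) (w : R -> R) (t b D : R) :
  is_derive t 1 A b -> is_derive t 1 w D ->
  is_derive t 1 (fun s => expR (A s) * w s) (expR (A t) * (b * w t + D)).
Proof.
move=> dA dw.
have dE : is_derive t 1 (expR \o A) (b * expR (A t)).
  by rewrite mulrC; exact: is_derive1_comp.
have H := is_deriveM dE dw.
refine (is_derive_eq H _).
rewrite /GRing.scale/=; ring.
Qed.

(** The largest value [M] of all [w_i] over [[ts, T]] cannot be positive: at the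
index [i] and time [c i] where it is attained, [exp A_i * (w_i - M)] vanishes,
whereas it starts from a negative value and its derivative is nonpositive because
all delayed values are at most [M]. *)
Lemma comparison (w : V -> R -> R) (ts : R) : 0 <= ts ->
  (forall i t, ts - hb <= t <= ts -> w i t <= 0) ->
  (forall i, locally_abs_continuous ts (w i)) ->
  (forall i, {ae mu, forall t, ts <= t ->
     exists2 D : R, is_derive t 1 (w i) D & D <= damped_dynamics a h d w i t}) ->
  forall i t, ts <= t -> w i t <= 0.
Proof.
move=> ts0 whist wac wder i0 T tsT; rewrite leNgt; apply/negP => wi0.
have /choice[c cP] (i : V) : exists c, ts <= c <= T /\
    forall t, ts <= t <= T -> w i t <= w i c.
  have [|c cI cP] := @EVT_max R (fun t => w i (Order.max ts t)) ts T tsT.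
    by apply: continuous_subspaceT; exact: ac_continuous.
  have cI' : ts <= c <= T by move: cI; rewrite in_itv.
  exists c; split => // t tt; have := cP t; rewrite in_itv/= tt => /(_ isT).
  by rewrite !max_r //; lra.
pose i := [arg max_(i > i0) w i (c i)]%O.
have iP j : w j (c j) <= w i (c i).
  by rewrite /i; case: arg_maxP => // k _; apply.
set M := w i (c i).
have M0 : 0 < M.
  apply: (lt_le_trans wi0); apply: le_trans (iP i0).
  by apply: (cP i0).2; lra.
have wM j t : ts - hb <= t <= T -> w j t <= M.
  move=> tt; have [tts|tst] := leP t ts.
    by apply: le_trans (ltW M0); apply: whist; lra.
  by apply: le_trans (iP j); apply: (cP j).2; lra.
have [/andP[tsc cT] _] := cP i.
pose A := primitive (rate i) ts.
pose f s := expR (A s) * (w i s - M).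
have : f (c i) <= f ts.
  apply: ac_nonincreasing => //.
    apply: acM; first by apply: ac_expR; apply: primitive_ac => //; exact: rate_summable.
    apply: acB => //; exact: ac_cst.
  move: (primitive_derive (rate_summable i) ts0).
  apply: ae_impl2 (wder i) => t wt At /andP[tst tc].
  have {wt}[D wD Dle] := wt tst.
  have {}At := At tst.
  have wMD : is_derive t 1 (fun s => w i s - M) D.
    by apply: is_derive_eq; rewrite subr0.
  exists (expR (A t) * (rate i t * (w i t - M) + D)).
    exact: is_derive_integrating_factor.
  rewrite pmulr_rle0 ?expR_gt0//.
  have t0 : 0 <= t by lra.
  have infl : inflow w i t <= (\sum_(j | j != i) a i j t) * M.
    rewrite mulr_suml; apply: ler_sum => j _; rewrite ler_wpM2l ?a_ge0//.
    by apply: wM; have := h_bnd i j t0; lra.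
  have := d_ge0 i t0.
  move: Dle; rewrite damped_dynamicsE /rate; nra.
have A0 : A ts = 0 by apply: primitive_id => //; exact: rate_summable.
rewrite /f -/M subrr mulr0 A0 expR0 mul1r.
have := whist i ts; have hb0 : 0 <= hb by have := h_bnd i i ts0; lra.
lra.
Qed.

End Comparison.

(** * Existence of a solution with constant initial data *)

Section SummableM.
Context {R : realType}.
Notation L := (lebesgueTypeR R).
Notation cmu := (@completed_lebesgue_measure R).

Lemma summable_bddM (u f : R -> R) (C : R) :
  lebesgue_measurable_fun `[0, +oo[ u -> (forall t, 0 <= t -> `|u t| <= C) ->
  locally_summable f -> locally_summable (fun t => f t * u t).
Proof.
move=> mu_ uC lf T T0.
have mT := lebesgue_measurable_itv `[0, T].
have [mf _] := integrableP _ _ _ (lf T T0).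
have mu1 : measurable_fun (`[0, T]%classic : set L) u.
  apply: (measurable_funS _ _ mu_); first exact: lebesgue_measurable_itv.
  by apply: subset_itv; rewrite bnd_simp.
have iC : cmu.-integrable `[0, T] (fun t => (C%:E * (EFin \o f) t)%E).
  exact: integrableZl (lf T T0).
apply: (le_integrable mT _ _ iC).
  by apply/measurable_EFinP; apply: measurable_funM => //; exact/measurable_EFinP.
move=> t; rewrite /= in_itv/= => /andP[t0 _].
rewrite lee_fin !normrM mulrC ler_wpM2r//.
by rewrite (le_trans (uC t t0))// ler_norm.
Qed.

Lemma primitive_le (f g : R -> R) (a t : R) :
  locally_summable f -> locally_summable g -> 0 <= a ->
  (forall s, a <= s -> f s <= g s) -> primitive f a t <= primitive g a t.
Proof.
move=> lf lg a0 fg; apply: le_Rintegral.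
- exact: lebesgue_measurable_itv.
- exact: summable_integrable.
- exact: summable_integrable.
- by move=> s; rewrite /= in_itv/= => /andP[/fg].
Qed.

Lemma primitive_ge0 (f : R -> R) (a t : R) :
  (forall s, a <= s -> 0 <= f s) -> 0 <= primitive f a t.
Proof.
by move=> f0; apply: Rintegral_ge0 => s; rewrite /= in_itv/= => /andP[/f0].
Qed.

Lemma primitive_cvg (f_ : nat -> R -> R) (f g : R -> R) (a t : R) :
  0 <= a -> (forall n, locally_summable (f_ n)) -> locally_summable f ->
  locally_summable g -> (forall n s, a <= s -> `|f_ n s| <= g s) ->
  (forall s, a <= s -> f_ n s @[n --> \oo] --> f s) ->
  primitive (f_ n) a t @[n --> \oo] --> primitive f a t.
Proof.
move=> a0 lf_ lf lg fg f_f.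
have mT := lebesgue_measurable_itv `[a, t].
have [|||||_ _] := @dominated_convergence _ L R cmu `[a, t]%classic mT
  (fun n => EFin \o f_ n) (EFin \o f) (EFin \o g).
- by move=> n; have /integrableP[] := summable_integrable t (lf_ n) a0.
- by have /integrableP[] := summable_integrable t lf a0.
- apply: aeW => s; rewrite /= in_itv/= => /andP[as_ _].
  by apply: cvg_EFin; [exact: nearW|exact: f_f].
- exact: summable_integrable.
- apply: aeW => s n; rewrite /= in_itv/= => /andP[as_ _].
  by rewrite lee_fin; exact: fg.
move=> H.
rewrite /primitive /Rintegral.
apply: fine_cvg => /=.
rewrite fineK //.
by apply: integrable_fin_num => //; exact: summable_integrable.
Qed.

Lemma ac_ext (E : normedModType R) (a : R) (f g : R -> E) :
  (forall t, a <= t -> f t = g t) -> locally_abs_continuous a f ->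
  locally_abs_continuous a g.
Proof.
move=> fg acf; apply: (ac_dominated _ acf acf) => T _; exists 1 => // u v au uv _.
by rewrite !fg ?(le_trans au)// mul1r lerDl.
Qed.

End SummableM.

Lemma ae_neq {R : realType} (c : R) : {ae @lebesgue_measure R, forall t, t <> c}.
Proof.
exists [set c]; split; [exact: measurable_set1|exact: lebesgue_measure_set1|].
by move=> t /= /contrapT.
Qed.

Section Existence.
Variables (R : realType) (V : finType) (hb : R).
Variables (a h : V -> V -> R -> R) (d : V -> R -> R) (ts : R).
Notation mu := (@lebesgue_measure R).
Hypothesis a_ge0 : forall i j t, 0 <= t -> 0 <= a i j t.
Hypothesis a_int : forall i j, locally_summable (a i j).
Hypothesis d_ge0 : forall i t, 0 <= t -> 0 <= d i t.
Hypothesis d_int : forall i, locally_summable (d i).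
Hypothesis h_meas : forall i j, lebesgue_measurable_fun `[0, +oo[ (h i j).
Hypothesis ts_ge0 : 0 <= ts.

Let A i := primitive (rate a d i) ts.

(** Variation of constants: [y] solves the damped dynamics from the constant
history one exactly when [exp A_i * y_i - 1] is the primitive of [source y i]. *)
Definition source (y : V -> R -> R) i (s : R) : R := expR (A i s) * inflow a h y i s.

Definition picard (y : V -> R -> R) i (t : R) : R :=
  if t <= ts then 1 else expR (- A i t) * (1 + primitive (source y i) ts t).

(** Borel rather than Lebesgue measurability: composing a Borel function with the
Lebesgue measurable map [s - h_ij s] stays measurable. *)
Definition picard_inv (y : V -> R -> R) := forall i,
  measurable_fun setT (y i) /\ forall t, 0 <= y i t <= 1.

Let rate_ls i : locally_summable (rate a d i).
Proof. exact: rate_summable. Qed.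

Let A_ts i : A i ts = 0.
Proof. by apply: primitive_id. Qed.

Let A_ac i : locally_abs_continuous ts (A i).
Proof. by apply: primitive_ac. Qed.

Let A_max i (t : R) : A i t = A i (Order.max ts t).
Proof.
have [//|tts] := leP ts t.
by rewrite A_ts /A /primitive set_itv_ge ?bnd_simp -?ltNge// Rintegral_set0.
Qed.

Let A_measurable i : measurable_fun setT (A i).
Proof.
apply: continuous_measurable_fun => t.
rewrite (_ : A i = fun t => A i (Order.max ts t)); last exact/funext/A_max.
exact: ac_continuous.
Qed.

Let borel_lebesgue_comp (y g : R -> R) : measurable_fun setT y ->
  lebesgue_measurable_fun `[0, +oo[ g -> lebesgue_measurable_fun `[0, +oo[ (y \o g).
Proof. by move=> my mg; exact: measurableT_comp. Qed.

Let meas_id : lebesgue_measurable_fun `[0, +oo[ (@id R).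
Proof.
by move=> _ B mB; apply: measurableI; [exact: lebesgue_measurable_itv|exact: borel_lebesgue].
Qed.

Lemma source_summable y i : picard_inv y -> locally_summable (source y i).
Proof.
move=> yP T T0.
(* [exp A_i] is bounded on [[0, T]] only, so it is frozen after [T] *)
have [M M0 MP] := ac_bounded (Order.max ts T) (ac_expR (A_ac i)).
pose g (s : R) := expR (A i (Order.min s T)).
have gM s : `|g s| <= M.
  rewrite /g A_max; apply: MP; rewrite le_max lexx/=.
  rewrite ge_max le_max lexx/= le_max; apply/orP; right.
  by rewrite ge_min lexx orbT.
have mg : lebesgue_measurable_fun `[0, +oo[ g.
  apply: (borel_lebesgue_comp (y := g)) meas_id.
  apply: (measurableT_comp (f := expR)) => //.
  apply: (measurableT_comp (f := A i)) => //.
  by apply: measurable_minr.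
suff : locally_summable (fun s => \sum_(j | j != i) a i j s * (g s * y j (s - h i j s))).
  move=> /(_ T T0); apply: eq_integrable; first exact: lebesgue_measurable_itv.
  move=> s; rewrite inE/= in_itv/= => /andP[s0 sT].
  rewrite /source /inflow mulr_sumr; congr EFin; apply: eq_bigr => j _.
  by rewrite /g min_l// mulrCA.
apply: summable_sum => j _; apply: (summable_bddM (C := M)) => //.
- apply: measurable_funM; first exact: mg.
  apply: (borel_lebesgue_comp (y := y j)); first exact: (yP j).1.
  exact: (measurable_funB meas_id (h_meas i j)).
- move=> t t0; rewrite normrM -[leRHS]mulr1 ler_pM//.
  by have := (yP j).2 (t - h i j t); rewrite ler_norml; lra.
Qed.

Lemma source_le y z i (s : R) : picard_inv y -> picard_inv z ->
  (forall i s, y i s <= z i s) -> ts <= s -> 0 <= source y i s <= source z i s.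
Proof.
move=> yP zP yz ss; have s0 : 0 <= s by exact: le_trans ss.
apply/andP; split.
  apply: mulr_ge0; first exact: expR_ge0.
  apply: sumr_ge0 => j _; apply: mulr_ge0; first exact: a_ge0.
  by case/andP: ((yP j).2 (s - h i j s)).
rewrite ler_pM2l ?expR_gt0//; apply: ler_sum => j _.
by rewrite ler_wpM2l// a_ge0.
Qed.

Lemma picard_le y z : picard_inv y -> picard_inv z ->
  (forall i s, y i s <= z i s) -> forall i s, picard y i s <= picard z i s.
Proof.
move=> yP zP yz i s; rewrite /picard; case: ifP => // _.
rewrite ler_pM2l ?expR_gt0// lerD2l.
apply: primitive_le => //; [exact: source_summable|exact: source_summable|].
by move=> r tr; case/andP: (source_le i yP zP yz tr).
Qed.

Lemma picard_inv_one : picard_inv (fun=> cst 1).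
Proof. by move=> i; split=> // t; rewrite /= ler01 lexx. Qed.

Lemma coefficients_derive (y : V -> R -> R) i : picard_inv y ->
  {ae mu, forall t, ts <= t ->
    is_derive t 1 (A i) (rate a d i t) /\
    is_derive t 1 (primitive (source y i) ts) (source y i t)}.
Proof.
move=> yP.
have H := primitive_derive (source_summable i yP) ts_ge0.
move: (primitive_derive (rate_ls i) ts_ge0) H; apply: ae_impl2 => t h1 h2 tst.
by split; [exact: h1|exact: h2].
Qed.

(** The constant one is a supersolution: [1 + primitive (source 1) - exp A_i]
vanishes at [ts] and has derivative [- d_i * exp A_i <= 0]. *)
Lemma picard_one_le1 i s : picard (fun=> cst 1) i s <= 1.
Proof.
rewrite /picard; case: (leP s ts) => [_|tss]; first exact: lexx.
rewrite expRN -ler_pdivlMl ?invr_gt0 ?expR_gt0// invrK mulr1.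
pose f t := 1 + primitive (source (fun=> cst 1) i) ts t - expR (A i t).
have : f s <= f ts.
  apply: ac_nonincreasing; first exact: ltW.
    apply: acB; last exact: ac_expR.
    apply: acD; first exact: ac_cst.
    by apply: primitive_ac => //; apply: source_summable; exact: picard_inv_one.
  move: (coefficients_derive i picard_inv_one); apply: ae_impl => t ht /andP[tst _].
  have [dA dP] := ht tst.
  exists (0 + source (fun=> cst 1) i t - rate a d i t * expR (A i t)).
    apply: is_deriveB.
    by rewrite mulrC; exact: is_derive1_comp.
  rewrite add0r /source mulrC -mulrBl pmulr_lle0 ?expR_gt0//.
  rewrite /inflow /rate; under eq_bigr do rewrite mulr1.
  have := d_ge0 i (le_trans ts_ge0 tst); lra.
rewrite /f A_ts expR0 primitive_id//; last by apply: source_summable; exact: picard_inv_one.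
lra.
Qed.

Lemma picard_inv_step y : picard_inv y -> picard_inv (picard y).
Proof.
move=> yP i; split.
  apply: measurable_fun_ifT => //.
    exact: measurable_fun_ler.
  apply: measurable_funM.
    by apply: (measurableT_comp (f := expR)) => //; exact: measurableT_comp.
  apply: measurable_funD => //.
  apply: continuous_measurable_fun => t.
  rewrite (_ : primitive _ _ = fun t => primitive (source y i) ts (Order.max ts t)).
    by apply: ac_continuous; apply: primitive_ac => //; exact: source_summable.
  apply/funext => r; have [//|tts] := leP ts r.
  rewrite primitive_id//; last exact: source_summable.
  by rewrite /primitive set_itv_ge ?bnd_simp -?ltNge// Rintegral_set0.
move=> t; apply/andP; split.
  rewrite /picard; case: ifP => // _; rewrite mulr_ge0 ?expR_ge0// addr_ge0//.
  apply: primitive_ge0 => s ss.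
  by case/andP: (source_le i yP yP (fun i s => lexx _) ss).
apply: le_trans (picard_one_le1 i t); apply: picard_le => //; first exact: picard_inv_one.
by move=> j s; case/andP: ((yP j).2 s).
Qed.

Definition picard_seq (n : nat) := iter n picard (fun=> cst 1).

Lemma picard_seq_inv n : picard_inv (picard_seq n).
Proof. by elim: n => [|n IH]; [exact: picard_inv_one|exact: picard_inv_step]. Qed.

Lemma picard_seq_dec n i t : picard_seq n.+1 i t <= picard_seq n i t.
Proof.
elim: n i t => [|n IH] i t; first exact: picard_one_le1.
exact: (picard_le (picard_seq_inv n.+1) (picard_seq_inv n) IH).
Qed.

Definition picard_lim i t : R := limn (fun n => picard_seq n i t).

Lemma picard_lim_cvg i t : picard_seq n i t @[n --> \oo] --> picard_lim i t.
Proof.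
apply: nonincreasing_is_cvgn.
  by apply/nonincreasing_seqP => n; exact: picard_seq_dec.
by exists 0 => _ [n _ <-]; case/andP: ((picard_seq_inv n i).2 t).
Qed.

Lemma picard_lim_inv : picard_inv picard_lim.
Proof.
move=> i; split.
  apply: (measurable_fun_cvg (h := fun n => picard_seq n i)).
    by move=> n; exact: (picard_seq_inv n i).1.
  by move=> t _; exact: picard_lim_cvg.
move=> t; apply/andP; split.
- apply: limr_ge; first exact: cvgP (@picard_lim_cvg i t).
  by apply: nearW => n; case/andP: ((picard_seq_inv n i).2 t).
- apply: limr_le; first exact: cvgP (@picard_lim_cvg i t).
  by apply: nearW => n; case/andP: ((picard_seq_inv n i).2 t).
Qed.

Lemma picard_lim_fix i t : picard_lim i t = picard picard_lim i t.
Proof.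
have h1 : picard_seq n.+1 i t @[n --> \oo] --> picard_lim i t.
  by move: (@picard_lim_cvg i t); rewrite -cvg_shiftS.
have h2 : picard_seq n.+1 i t @[n --> \oo] --> picard picard_lim i t.
  rewrite /picard_seq/= /picard; case: ifP => _; first exact: cvg_cst.
  apply: cvgM; first exact: cvg_cst.
  apply: cvgD; first exact: cvg_cst.
  apply: (@primitive_cvg _ _ _ (source (fun=> cst 1) i)) => //.
  - by move=> n; apply: source_summable; exact: picard_seq_inv.
  - by apply: source_summable; exact: picard_lim_inv.
  - by apply: source_summable; exact: picard_inv_one.
  - move=> n s ss; have /andP[H1 H2] := source_le i (picard_seq_inv n) picard_inv_one
      (fun j r => proj2 (andP ((picard_seq_inv n j).2 r))) ss.
    by rewrite ger0_norm.
  - move=> s ss; apply: cvgM; first exact: cvg_cst.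
    apply: cvg_big => [|j _]; first exact: add_continuous.
    apply: cvgM; first exact: cvg_cst.
    exact: picard_lim_cvg.
exact: (cvg_unique _ h1 h2).
Qed.

(** The iterates of [picard] from the constant one decrease and stay nonnegative;
their limit is a fixed point by dominated convergence, and a fixed point is
absolutely continuous and satisfies the equation by the product rule. *)
Lemma damped_solution_exists : exists2 y : V -> R -> R,
  solution hb (damped_dynamics a h d) ts (fun=> 1) (fun=> cst 1) y &
  forall i t, t <= ts -> y i t = 1.
Proof.
have y1 i t : t <= ts -> picard_lim i t = 1.
  by move=> tts; rewrite picard_lim_fix /picard tts.
exists picard_lim => // i.
have ysrc := source_summable i picard_lim_inv.
pose u t := expR (- A i t) * (1 + primitive (source picard_lim i) ts t).
have yu t : ts <= t -> picard_lim i t = u t.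
  rewrite le_eqVlt => /predU1P[<-|tst].
    by rewrite y1// /u A_ts primitive_id// oppr0 expR0 addr0 mulr1.
  by rewrite picard_lim_fix /picard leNgt tst.
split; first exact: y1.
- by move=> s; rewrite in_itv/= => /andP[_ s0]; apply: y1; lra.
- apply: (@ac_ext _ _ _ u); first by move=> t /yu.
  apply: acM.
    apply: ac_expR.
    apply: (ac_ext (f := fun t => (-1) * A i t)); last exact: acZ.
    by move=> t _; rewrite mulN1r.
  by apply: acD; [exact: ac_cst|exact: primitive_ac].
- move: (ae_neq ts) (coefficients_derive i picard_lim_inv).
  apply: ae_impl2 => t tnts dt tst; have [dA dP] := dt tst.
  have {tnts}tst' : ts < t by rewrite lt_neqAle tst andbT eq_sym; exact/eqP.
  apply: (@near_eq_is_derive _ _ _ u).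
    near=> s; rewrite yu//; apply: ltW; near: s; exact: lt_nbhsr.
  rewrite damped_dynamicsE yu//.
  have dN : is_derive t 1 (fun s => - A i s) (- rate a d i t) by exact: is_deriveN.
  have d1 : is_derive t 1 (fun s => 1 + primitive (source picard_lim i) ts s)
      (0 + source picard_lim i t) by exact: is_deriveD.
  refine (is_derive_eq (is_derive_integrating_factor dN d1) _).
  have e1 : expR (- A i t) * expR (A i t) = 1 by rewrite -expRD addNr expR0.
  by rewrite add0r /u /source -[in RHS](mul1r (inflow _ _ _ _ _)) -e1; ring.
Unshelve. all: by end_near. Qed.

End Existence.

(** * Projection on a closed convex set *)

Section Projection.
Context {R : realType} {m : nat}.
Implicit Types n u v w x z : 'rV[R]_m.

Definition dot u v : R := \sum_(k < m) u ord0 k * v ord0 k.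

Lemma dotC u v : dot u v = dot v u.
Proof. by apply: eq_bigr => k _; rewrite mulrC. Qed.

Lemma dotDr u v w : dot u (v + w) = dot u v + dot u w.
Proof. by rewrite -big_split; apply: eq_bigr => k _; rewrite mxE mulrDr. Qed.

Lemma dotZr u c v : dot u (c *: v) = c * dot u v.
Proof. by rewrite mulr_sumr; apply: eq_bigr => k _; rewrite mxE mulrCA. Qed.

Lemma dotBr u v w : dot u (v - w) = dot u v - dot u w.
Proof. by rewrite dotDr -scaleN1r dotZr mulN1r. Qed.

Lemma dotBl u v w : dot (u - v) w = dot u w - dot v w.
Proof. by rewrite dotC dotBr !(dotC w). Qed.

Lemma dot_sumr (I : finType) (P : pred I) u (f : I -> 'rV[R]_m) :
  dot u (\sum_(i | P i) f i) = \sum_(i | P i) dot u (f i).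
Proof.
rewrite exchange_big/=; apply: eq_bigr => k _.
by rewrite summxE mulr_sumr.
Qed.

Lemma dot_ge0 u : 0 <= dot u u.
Proof. by apply: sumr_ge0 => k _; rewrite -expr2 sqr_ge0. Qed.

Lemma euclidean_normE u : euclidean_norm u = Num.sqrt (dot u u).
Proof. by congr Num.sqrt; apply: eq_bigr => k _; rewrite expr2. Qed.

Lemma coord_le_norm v (k : 'I_m) : `|v ord0 k| <= `|v|.
Proof.
rewrite [leRHS]/Num.Def.normr/= mx_normrE.
exact: (le_bigmax _ (fun ij : 'I_1 * 'I_m => `|v ij.1 ij.2|) (ord0, k)).
Qed.

Lemma coord_le_euclidean v (k : 'I_m) : `|v ord0 k| <= euclidean_norm v.
Proof.
rewrite -sqrtr_sqr ler_wsqrtr// (bigD1 k)//= lerDl.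
by apply: sumr_ge0 => j _; rewrite sqr_ge0.
Qed.

Lemma norm_le_euclidean v : `|v| <= euclidean_norm v.
Proof.
rewrite [leLHS]/Num.Def.normr/= mx_normrE bigmax_le ?sqrtr_ge0// => -[i k] _ /=.
by rewrite (ord1 i); exact: coord_le_euclidean.
Qed.

Lemma dot_bound n v : (forall k, `|n ord0 k| <= 1) -> dot n v <= m%:R * `|v|.
Proof.
move=> n1; rewrite (_ : m%:R * `|v| = \sum_(k < m) `|v|); last first.
  by rewrite sumr_const card_ord mulr_natl.
apply: ler_sum => k _; rewrite (le_trans (ler_norm _))// normrM -[leRHS]mul1r.
by rewrite ler_pM// coord_le_norm.
Qed.

Lemma euclidean_dist_ge0 x (A : set 'rV[R]_m) : 0 <= euclidean_dist x A.
Proof.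
have [->|A0] := eqVneq A set0; first by rewrite /euclidean_dist image_set0 inf0.
apply: lb_le_inf; last by move=> _ [w _ <-]; exact: sqrtr_ge0.
by apply: image_nonempty; exact/set0P.
Qed.

Lemma euclidean_dist_le x z (A : set 'rV[R]_m) : A z ->
  euclidean_dist x A <= euclidean_norm (x - z).
Proof.
move=> Az; apply: ge_inf; last by exists z.
by exists 0 => _ [w _ <-]; exact: sqrtr_ge0.
Qed.

Lemma dot_continuous x : continuous (fun w => dot (x - w) (x - w)).
Proof.
apply: continuous_big => [|k _ w]; first exact: add_continuous.
have c : (x - w') ord0 k @[w' --> w] --> (x - w) ord0 k.
  apply: (@continuous_comp _ _ _ (fun w' => x - w') (fun M : 'rV[R]_m => M ord0 k)).
    by apply: (@continuousB _ _ _ (cst x) id); [exact: cst_continuous|].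
  exact: coord_continuous.
exact: (cvgM c c).
Qed.

(** The points of [A] no farther from [x] than a given one form a compact set. *)
Lemma projection_exists x (A : set 'rV[R]_m) : A !=set0 -> closed A ->
  exists2 z, A z & forall w, A w -> dot (x - z) (x - z) <= dot (x - w) (x - w).
Proof.
move=> [w0 Aw0] cA.
pose q w := dot (x - w) (x - w).
pose K := A `&` [set w | q w <= q w0].
have K0 : K !=set0 by exists w0; split => //=.
have cK : compact K.
  apply: bounded_closed_compact.
    exists (`|x| + Num.sqrt (q w0)); split; first exact: num_real.
    move=> M ltM w [_ /= qw]; apply: le_trans (ltW ltM).
    rewrite -[w](subKr x) (le_trans (ler_normB _ _))// lerD2l.
    by rewrite (le_trans (norm_le_euclidean _))// euclidean_normE ler_wsqrtr.
  apply: closedI => //.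
  apply: (@preimage_closed _ R q [set r : R | r <= q w0]).
    by move=> w _; exact: dot_continuous.
  exact: (@closed_le R (q w0)).
have [z zK zmin] := EVT_min_rV K0 cK (continuous_subspaceT (@dot_continuous x)).
rewrite inE in zK; exists z; first exact: zK.1.
move=> w Aw; have [qw|qw] := leP (q w) (q w0).
  by apply: zmin; rewrite inE.
by apply: le_trans (ltW qw); exact: zK.2.
Qed.

(** Moving from [z] a proportion [l] of the way towards [w] stays in [A] and
changes the squared distance to [x] by
[- 2 l <x - z, w - z> + l^2 |w - z|^2], which must be nonnegative for small
[l]. *)
Lemma projection_obtuse x z (A : set 'rV[R]_m) : convex_set A -> A z ->
  (forall w, A w -> dot (x - z) (x - z) <= dot (x - w) (x - w)) ->
  forall w, A w -> dot (x - z) (w - z) <= 0.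
Proof.
move=> cA Az zmin w Aw.
have key (l : R) : 0 < l -> l <= 1 ->
    2 * dot (x - z) (w - z) <= l * dot (w - z) (w - z).
  move=> l0 l1.
  have := cA w z (Itv01 (ltW l0) l1) (mem_set Aw) (mem_set Az).
  rewrite inE => /zmin.
  have -> : x - @conv R (convex_lmodType 'rV[R]_m) (Itv01 (ltW l0) l1) w z = (x - z) - l *: (w - z).
    apply/rowP => k; rewrite /conv/= !mxE/= /unstable.onem. ring.
  move: (x - z) (w - z) => u v.
  rewrite dotBr !dotBl dotZr ![dot (_ *: _) _]dotC !dotZr [dot (_ *: _) v]dotC dotZr => h.
  rewrite -(ler_pM2l l0); lra.
apply/ler_addgt0Pr => e e0; rewrite add0r.
rewrite leNgt; apply/negP => ed.
pose D := dot (w - z) (w - z).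
have D0 : 0 <= D by exact: dot_ge0.
pose l := Order.min 1 (e / (1 + D)).
have l0 : 0 < l by rewrite lt_min ltr01 divr_gt0//; lra.
have l1 : l <= 1 by rewrite ge_min lexx.
have := key l l0 l1; rewrite -/D.
have lD : l * D <= e.
  rewrite (@le_trans _ _ (e / (1 + D) * (1 + D)))//.
    by apply: ler_pM; [exact: ltW|exact: D0|rewrite ge_min lexx orbT|rewrite lerDr].
  by rewrite divfK// gt_eqF//; lra.
lra.
Qed.

(** The half-space is orthogonal to the segment from [x] to its projection [z],
and [n] is the unit vector along that segment.  Only the bound on the
coordinates of [n] is recorded: it suffices to estimate [dot n] uniformly. *)
Lemma support_halfspace x (A : set 'rV[R]_m) : A !=set0 -> closed A -> convex_set A ->
  0 < euclidean_dist x A ->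
  exists n (s : R), [/\ forall k, `|n ord0 k| <= 1, forall w, A w -> dot n w <= s &
     euclidean_dist x A <= dot n x - s].
Proof.
move=> A0 clA cvA dpos.
have [z Az zmin] := projection_exists x A0 clA.
have obt := projection_obtuse cvA Az zmin.
pose D := euclidean_norm (x - z).
have dD : euclidean_dist x A <= D by exact: euclidean_dist_le.
have D0 : 0 < D by exact: lt_le_trans dD.
have DD : D * D = dot (x - z) (x - z).
  by rewrite /D euclidean_normE -expr2 sqr_sqrtr// dot_ge0.
exists (D^-1 *: (x - z)), (D^-1 * dot (x - z) z); split.
- move=> k; rewrite mxE normrM gtr0_norm ?invr_gt0// mulrC ler_pdivrMr// mul1r.
  exact: coord_le_euclidean.
- move=> w /obt; rewrite dotBr => h; rewrite dotC dotZr (dotC w).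
  by rewrite ler_pM2l ?invr_gt0//; lra.
- rewrite dotC dotZr (dotC x) -mulrBr -dotBr -DD mulrA mulVf ?mul1r//.
  by rewrite gt_eqF.
Qed.

End Projection.

Lemma continuous_borel_measurable_comp (R : realType) (E F : normedModType R)
    (D : set R) (f : R -> E) (g : E -> F) : measurable D -> continuous g ->
  borel_measurable_fun D f -> borel_measurable_fun D (g \o f).
Proof.
move=> mD cg mf; rewrite /borel_measurable_fun.
apply: (@measurability _ _ _ (g_sigma_algebraType (@open F)) D (g \o f) (@open F)) => //.
move=> _ [U oU <-]; rewrite comp_preimage.
apply: mf => //; apply: sub_sigma_algebra.
by apply: open_comp oU => c _; exact: cg.
Qed.

Section RowVectors.
Variables (R : realType) (m : nat).

Lemma is_derive_dot (n : 'rV[R]_m) (x : R -> 'rV[R]_m) (t : R) (D : 'rV[R]_m) :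
  is_derive t 1 x D -> is_derive t 1 (fun s => dot n (x s)) (dot n D).
Proof.
move=> [dx Dx].
have dk k : is_derive t 1 (fun s => n ord0 k * x s ord0 k) (n ord0 k * D ord0 k).
  have dxk : derivable (fun s => x s ord0 k) t 1 by exact: (derivable_mxP _ _ _).1.
  have Dk : is_derive t 1 (fun s => x s ord0 k) (D ord0 k).
    by apply: DeriveDef => //; rewrite -Dx derive_mx// mxE.
  exact: is_deriveZ.
rewrite (_ : (fun s => dot n (x s)) = \sum_(k < m) (fun s => n ord0 k * x s ord0 k)).
  exact: is_derive_sum.
by apply/funext => s; rewrite fct_sumE.
Qed.

Lemma ac_dot (n : 'rV[R]_m) (x : R -> 'rV[R]_m) (t0 : R) :
  locally_abs_continuous t0 x -> locally_abs_continuous t0 (fun s => dot n (x s)).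
Proof.
move=> acx; apply: ac_sum => k _; apply: acZ.
apply: (ac_dominated _ acx acx) => T _; exists 1 => // u v _ _ _.
rewrite mul1r (@le_trans _ _ `|x v - x u|) ?lerDl//.
by have := coord_le_norm (x v - x u) k; rewrite !mxE.
Qed.

Lemma norm_const_mx (c : R) : `|const_mx c : 'rV[R]_m| <= `|c|.
Proof.
rewrite [leLHS]/Num.Def.normr/= mx_normrE bigmax_le// => -[i k] _ /=.
by rewrite mxE.
Qed.

Lemma is_derive_const_mx (x : R -> R) (t D : R) :
  is_derive t 1 x D -> is_derive t 1 (fun s => const_mx (x s) : 'rV[R]_m) (const_mx D).
Proof.
move=> [dx Dx].
have dM : derivable (fun s => const_mx (x s) : 'rV[R]_m) t 1.
  apply/derivable_mxP => i k.
  by under eq_fun do rewrite mxE.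
apply: DeriveDef => //.
rewrite derive_mx//; apply/rowP => k; rewrite [LHS]mxE [RHS]mxE -Dx.
rewrite (_ : (fun s => _) = x)//.
by apply/funext => s; rewrite mxE.
Qed.

Lemma ac_const_mx (x : R -> R) (t0 : R) : locally_abs_continuous t0 x ->
  locally_abs_continuous t0 (fun s => const_mx (x s) : 'rV[R]_m).
Proof.
move=> acx; apply: (ac_dominated _ acx acx) => T _; exists 1 => // u v _ _ _.
rewrite mul1r (@le_trans _ _ `|x v - x u|) ?lerDl//.
apply: le_trans (norm_const_mx _); rewrite le_eqVlt; apply/orP; left; apply/eqP.
by congr (`|_|); apply/rowP => k; rewrite !mxE.
Qed.

Lemma const_mx_continuous : continuous (fun c : R => const_mx c : 'rV[R]_m).
Proof.
move=> c; apply/cvgrPdist_le => e e0; near=> c'.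
rewrite (_ : const_mx c - const_mx c' = const_mx (c - c')); last first.
  by apply/rowP => k; rewrite !mxE.
by rewrite (le_trans (norm_const_mx _))//; near: c'; exact: cvgr_dist_le.
Unshelve. all: by end_near. Qed.

End RowVectors.

(** * Damped dynamics and target aggregation *)

Section Main.
Variables (R : realType) (V : finType) (hb : R).
Variables (a h : V -> V -> R -> R) (d : V -> R -> R).
Hypothesis hb_ge0 : 0 <= hb.
Hypothesis a_ge0 : forall i j t, 0 <= t -> 0 <= a i j t.
Hypothesis a_int : forall i j, locally_summable (a i j).
Hypothesis d_ge0 : forall i t, 0 <= t -> 0 <= d i t.
Hypothesis d_int : forall i, locally_summable (d i).
Hypothesis h_bnd : forall i j t, 0 <= t -> 0 <= h i j t <= hb.
Hypothesis h_meas : forall i j, lebesgue_measurable_fun `[0, +oo[ (h i j).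

(** Subtracting a constant [c] leaves the coupling terms unchanged and adds
[d_i * c], so [x - c] and [- x - c] are subsolutions when [c >= 0]. *)
Lemma damped_affine (x : V -> R -> R) (k c : R) i t :
  damped_dynamics a h d (fun j s => k * x j s - c) i t =
  k * damped_dynamics a h d x i t + d i t * c.
Proof.
rewrite /damped_dynamics.
rewrite (eq_bigr (fun j => k * (a i j t * (x j (t - h i j t) - x i t)))).
  by rewrite -mulr_sumr; ring.
by move=> j _; ring.
Qed.

Lemma history_bound (E : normedModType R) (F : (V -> R -> E) -> V -> R -> E)
    (ts : R) (x0 : V -> E) (phi x : V -> R -> E) :
  admissible_history hb phi -> solution hb F ts x0 phi x ->
  exists2 C : R, 0 < C & forall i t, ts - hb <= t <= ts -> `|x i t| <= C.
Proof.
move=> hphi sx.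
have /choice[c cP] (i : V) : exists c : R, forall t, ts - hb <= t <= ts -> `|x i t| <= c.
  have [xts xphi _ _] := sx i.
  have [_ [M [_ MP]]] := hphi i.
  exists (Order.max `|x0 i| (M + 1)) => t /andP[t1]; rewrite le_eqVlt => /predU1P[->|t2].
    by rewrite xts le_max lexx.
  have tI : t - ts \in `[- hb, 0[ by rewrite in_itv/=; apply/andP; lra.
  rewrite -[t](subrKC ts) (xphi _ tI).
  rewrite le_max; apply/orP; right; apply: (MP (M + 1)); first by lra.
  by rewrite /= in_itv/=; apply/andP; lra.
exists (1 + \sum_i `|c i|); first by rewrite ltr_pwDl// sumr_ge0.
move=> i t tt; rewrite (le_trans (cP i t tt))// (le_trans (ler_norm _))//.
rewrite (bigD1 i)//= addrCA lerDl addr_ge0//; exact: sumr_ge0.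
Qed.

Lemma init_sup_norm_bound (F : (V -> R -> R) -> V -> R -> R)
    (ts : R) (x0 : V -> R) (phi x : V -> R -> R) :
  admissible_history hb phi -> solution hb F ts x0 phi x ->
  forall i t, ts - hb <= t <= ts -> `|x i t| <= init_sup_norm hb x0 phi.
Proof.
move=> hphi sx.
have [C C0 CP] := history_bound hphi sx.
set S := ([set `|x0 i| | i in [set: V]] `|`
       [set `|phi i s| | i in [set: V] & s in `[- hb, 0[]).
have xS i t : ts - hb <= t <= ts -> S `|x i t|.
  have [xts xphi _ _] := sx i.
  move=> /andP[t1]; rewrite le_eqVlt => /predU1P[->|t2].
    by left; exists i => //; rewrite xts.
  right; exists i => //; exists (t - ts); first by rewrite /= in_itv/=; apply/andP; lra.
  by rewrite -xphi ?subrKC// in_itv/=; apply/andP; lra.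
move=> i t tt; apply: ub_le_sup; last exact: xS.
exists C => r [[j _ <-]|[j _ [s + <-]]].
  have [<- _ _ _] := sx j; apply: CP; lra.
rewrite /= in_itv/= => ss.
have [_ xphi _ _] := sx j; rewrite -xphi ?in_itv//.
by apply: CP; lra.
Qed.

(** The supremum of the initial data bounds the solution for all times, so
[delta = e] works. *)
Lemma damped_stable : damped_lyapunov_stable hb a h d.
Proof.
move=> ts ts0 e e0; exists e => // x0 phi x hphi sx ltc i t tst.
set c := init_sup_norm hb x0 phi in ltc.
have xc := init_sup_norm_bound hphi sx; rewrite -/c in xc.
have hb0 : 0 <= hb by exact: hb_ge0.
have c0 : 0 <= c by apply: le_trans (xc i ts _) => //; lra.
have key (k : R) : `|k| = 1 -> k * x i t - c <= 0.
  move=> k1; apply: (@comparison R V hb a h d a_ge0 a_int d_ge0 d_int h_bnd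
    (fun j s => k * x j s - c) ts) => //.
  - move=> j s ss; rewrite subr_le0 (le_trans _ (xc j s ss))//.
    by rewrite (le_trans (ler_norm _))// normrM k1 mul1r.
  - move=> j; have [_ _ acx _] := sx j.
    by apply: acB; [exact: acZ|exact: ac_cst].
  - move=> j; have [_ _ _] := sx j; apply: ae_impl => s dx tss.
    exists (k * damped_dynamics a h d x j s - 0).
      apply: is_deriveB; exact: (is_deriveZ k (dx tss)).
    rewrite damped_affine subr0 lerDl mulr_ge0// d_ge0//; lra.
apply: le_lt_trans ltc; rewrite ler_norml.
have := key 1; have := key (-1); rewrite normrN normr1 => /(_ erefl) h1 /(_ erefl) h2.
by apply/andP; lra.
Qed.

Lemma damped_sub (u y : V -> R -> R) (s C : R) i t :
  damped_dynamics a h d (fun j r => u j r - s - C * y j r) i t =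
  \sum_(j | j != i) a i j t * (u j (t - h i j t) - u i t) + d i t * (s - u i t)
  - C * damped_dynamics a h d y i t.
Proof.
rewrite /damped_dynamics.
rewrite (eq_bigr (fun j => a i j t * (u j (t - h i j t) - u i t) -
                           C * (a i j t * (y j (t - h i j t) - y i t)))).
  by rewrite sumrB -mulr_sumr; ring.
by move=> j _; ring.
Qed.

(** The bound [C * y_i] on the signed distance to a half-space containing
[Omega] does not depend on the half-space, which may thus be chosen anew at each
time [t]. *)
Lemma aggregation_of_attraction (m : nat) (Omega : set 'rV[R]_m)
    (omega : V -> R -> 'rV[R]_m) :
  damped_attractive hb a h d ->
  Omega !=set0 -> closed Omega -> convex_set Omega ->
  (forall i t, 0 <= t -> Omega (omega i t)) ->
  target_aggregation hb a h d Omega omega.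
Proof.
move=> attr Om0 clO cvO omO ts x0 phi x ts0 hphi sx i.
have [y sy y1] := damped_solution_exists hb a_ge0 a_int d_ge0 d_int h_meas ts0.
have h1 : admissible_history hb (fun _ : V => cst (1 : R)).
  move=> j; split; first exact: measurable_cst.
  by exists 1; split => // M M1 s _; rewrite /= normr1 ltW.
have ycvg := attr ts _ _ y ts0 h1 sy i.
have [w0 Ow0] := Om0.
have [C1 C10 xC1] := history_bound hphi sx.
(* a bound on [dot n (x j r - w0)] over the initial window, valid for every [n]
   with coordinates in [[-1, 1]] *)
pose C := m%:R * (C1 + `|w0|).
have key t : ts <= t -> euclidean_dist (x i t) Omega <= `|C * y i t|.
  move=> tst; have [d0|dpos] := leP (euclidean_dist (x i t) Omega) 0.
    exact: le_trans d0 (normr_ge0 _).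
  have [n [s [n1 ns le_s]]] := support_halfspace Om0 clO cvO dpos.
  rewrite (le_trans le_s)// (le_trans _ (ler_norm _))// -subr_le0.
  apply: (@comparison R V hb a h d a_ge0 a_int d_ge0 d_int h_bnd
    (fun j r => dot n (x j r) - s - C * y j r) ts) => //.
  - move=> j r rr; rewrite y1; last by case/andP: rr.
    have h2 : dot n (x j r) - dot n w0 <= C.
      rewrite -dotBr (le_trans (dot_bound _ n1))// ler_wpM2l//.
      by rewrite (le_trans (ler_normB _ _))// lerD2r xC1.
    have := ns _ Ow0; lra.
  - move=> j; have [_ _ acx _] := sx j; have [_ _ acy _] := sy j.
    apply: acB; last exact: acZ.
    by apply: acB; [exact: ac_dot|exact: ac_cst].
  - move=> j; have [_ _ _ dx] := sx j; have [_ _ _ dy] := sy j.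
    move: dx dy; apply: ae_impl2 => r dx dy tsr.
    exists (dot n (target_dynamics a h d omega x j r) - 0
            - C * damped_dynamics a h d y j r).
      apply: is_deriveB; last exact: (is_deriveZ C (dy tsr)).
      by apply: is_deriveB; exact: is_derive_dot (dx tsr).
    rewrite (damped_sub (fun j r => dot n (x j r))) subr0 lerD2r.
    rewrite /target_dynamics dotDr dot_sumr dotZr dotBr.
    rewrite (eq_bigr (fun k => a j k r * (dot n (x k (r - h j k r)) - dot n (x j r)))); last first.
      by move=> k _; rewrite dotZr dotBr.
    have r0 : 0 <= r by exact: le_trans tsr.
    by rewrite lerD2l ler_wpM2l ?d_ge0// lerD2r ns//; exact: omO.
apply: (@squeeze_cvgr _ _ _ _ (cst 0) (fun t => `|C * y i t|)).
- near=> t.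
  have tst : ts <= t by near: t; apply: nbhs_pinfty_ge; exact: num_real.
  by rewrite euclidean_dist_ge0 key.
- exact: cvg_cst.
- rewrite -(normr0 R) -(mulr0 C); apply: cvg_norm; apply: cvgM => //; exact: cvg_cst.
Unshelve. all: by end_near. Qed.

(** Constant row vectors embed solutions of the damped dynamics into solutions
of the target dynamics with [omega = 0]; as [m >= 1], a coordinate recovers the
scalar solution from its distance to the origin. *)
Lemma attraction_of_aggregation (m : nat) : (1 <= m)%N ->
  target_aggregation hb a h d [set (0 : 'rV[R]_m)] (fun _ _ => 0) ->
  damped_attractive hb a h d.
Proof.
move=> m1 agg ts x0 phi x ts0 hphi sx i.
pose X (x : V -> R -> R) (i : V) (t : R) : 'rV[R]_m := const_mx (x i t).
have hX : admissible_history hb (X phi).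
  move=> j; have [mphi [M [Mr MP]]] := hphi j; split.
    exact: continuous_borel_measurable_comp (measurable_itv _) (@const_mx_continuous R m) mphi.
  exists M; split => // N MN s sI.
  by apply: (le_trans (norm_const_mx m (phi j s))); exact: MP.
have sX : solution hb (target_dynamics a h d (fun _ _ => 0)) ts
    (fun i => const_mx (x0 i)) (X phi) (X x).
  move=> j; have [e1 e2 acx dx] := sx j; split.
  - by rewrite /X e1.
  - by move=> s sI; rewrite /X e2.
  - exact: ac_const_mx.
  - move: dx; apply: ae_impl => t dx tst.
    have -> : target_dynamics a h d (fun _ _ => 0) (X x) j t =
        const_mx (damped_dynamics a h d x j t).
      apply/rowP => k; rewrite /target_dynamics /damped_dynamics !mxE summxE addrC.
      congr (_ + _); first by ring.
      by apply: eq_bigr => l _; rewrite !mxE.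
    exact: is_derive_const_mx (dx tst).
have Xcvg := agg ts _ _ _ ts0 hX sX i.
pose D t := euclidean_dist (X x i t) [set 0].
have xD t : `|x i t| <= D t.
  apply: lb_le_inf.
    by exists (euclidean_norm (X x i t - 0)), 0.
  move=> _ [w -> <-]; rewrite subr0.
  by have := coord_le_euclidean (X x i t) (Ordinal m1); rewrite mxE.
apply: (@squeeze_cvgr _ _ _ _ (fun t => - D t) D) => //.
- by near=> t; have := xD t; rewrite ler_norml.
- by rewrite -oppr0; exact: cvgN.
Unshelve. all: by end_near. Qed.

End Main.

Theorem lemma9 (R : realType) (V : finType) (m : nat) (hb : R)
    (a h : V -> V -> R -> R) (d : V -> R -> R)
    (V_nonempty : (0 < #|V|)%N) (m_ge1 : (1 <= m)%N) (hb_ge0 : 0 <= hb)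
    (a_ge0 : forall i j t, 0 <= t -> 0 <= a i j t)
    (a_int : forall i j, locally_summable (a i j))
    (d_ge0 : forall i t, 0 <= t -> 0 <= d i t)
    (d_int : forall i, locally_summable (d i))
    (h_bnd : forall i j t, 0 <= t -> 0 <= h i j t <= hb)
    (h_meas : forall i j, lebesgue_measurable_fun `[0, +oo[ (h i j)) :
  (forall (Omega : set 'rV[R]_m) (omega : V -> R -> 'rV[R]_m),
     Omega !=set0 -> closed Omega -> convex_set Omega ->
     admissible_target d Omega omega ->
     target_aggregation hb a h d Omega omega)
  <-> damped_asymptotically_stable hb a h d.
Proof.
split=> [agg|[_ attr] Omega omega Om0 clO cvO admO]; last first.
  apply: aggregation_of_attraction => // i t t0.
  by have [omO _ _] := admO i; exact: omO.
split; first exact: damped_stable.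
apply: (attraction_of_aggregation m_ge1); apply: agg.
- by exists 0.
- exact/accessible_closed_set1/hausdorff_accessible/norm_hausdorff.
- by move=> x y l; rewrite !inE => /= -> ->; exact: (@convmm R (convex_lmodType 'rV[R]_m)).
- by move=> i; split=> // k;
    [under eq_fun do rewrite mxE|under eq_fun do rewrite mxE mulr0]; exact: summable0.
Qed.
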